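(* For every $n\geq 1$, $$\sum_{e\in \mathbf{I}_n(\geq,\neq,>)} t^{\mathrm{Asc}(e)}=\sum_{e\in \mathbf{I}_n(>,-,>)} t^{\mathrm{Asc}(e)}.$$
   Context: An inversion sequence of length $n$ is a word $e=e_1e_2\cdots e_n$ of nonnegative integers with $0\leq e_i\leq i-1$ for all $i\in[n]=\{1,\dots,n\}$; $\mathbf{I}_n$ denotes the set of them. For relations $\rho_1,\rho_2,\rho_3\in\{<,>,\leq,\geq,=,\neq,-\}$ (where $-$ is the trivial relation holding for all pairs), $\mathbf{I}_n(\rho_1,\rho_2,\rho_3)$ is the set of $e\in\mathbf{I}_n$ for which there are no indices $1\leq i<j<k\leq n$ with $e_i\,\rho_1\, e_j$, $e_j\,\rho_2\, e_k$ and $e_i\,\rho_3\, e_k$. For a word $w=w_1\cdots w_n$, $\mathrm{Asc}(w)=\{i\in[n-1]: w_i<w_{i+1}\}$, and for a set $S$ of positive integers, $t^{S}$ denotes the monomial $\prod_{i\in S}t_i$ in commuting variables $t_1,t_2,\dots$. *)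

(* Defs.v *)
From HB Require Import structures.
From mathcomp Require Import all_boot all_order all_algebra.
From mathcomp Require Import mpoly.

Set Implicit Arguments.
Unset Strict Implicit.
Unset Printing Implicit Defensive.

Import GRing.Theory.

(* Positions are 0-based: e_(i+1) in the usual notation is [e i], so the bound
   0 <= e_i <= i - 1 on an inversion sequence reads [e i <= i]. Every entry is
   then < n, hence the finite codomain 'I_n loses nothing. *)
Definition invseq (n : nat) : {set {ffun 'I_n -> 'I_n}} :=
  [set e : {ffun 'I_n -> 'I_n} | [forall i : 'I_n, e i <= i]].

Definition contains_triple (n : nat) (r1 r2 r3 : rel nat)
    (e : {ffun 'I_n -> 'I_n}) : bool :=
  [exists i : 'I_n, exists j : 'I_n, exists k : 'I_n,
    [&& i < j, j < k, r1 (e i) (e j), r2 (e j) (e k) & r3 (e i) (e k)]].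

Definition invseq_avoid (n : nat) (r1 r2 r3 : rel nat) :
    {set {ffun 'I_n -> 'I_n}} :=
  [set e in invseq n | ~~ contains_triple r1 r2 r3 e].

Definition neqn : rel nat := [rel x y | x != y].
Definition anyn : rel nat := [rel _ _ | true].

(* The 0-based position i stands for the ascent i + 1; the last position is
   never an element since it has no successor in 'I_n. *)
Definition Asc (n : nat) (e : {ffun 'I_n -> 'I_n}) : {set 'I_n} :=
  [set i : 'I_n | [exists j : 'I_n, (val j == (val i).+1) && (e i < e j)]].

(* The variable t_(i+1) is 'X_i; only t_1, ..., t_(n-1) can occur for words of
   length n, so n variables suffice. *)
Definition tmon (n : nat) (S : {set 'I_n}) : {mpoly int[n]} :=
  (\prod_(i in S) 'X_i)%R.

(* Main.v *)
Require Import Defs.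
From HB Require Import structures.
From mathcomp Require Import all_boot all_order all_algebra.
From mathcomp Require Import mpoly ring.

Set Implicit Arguments.
Unset Strict Implicit.
Unset Printing Implicit Defensive.

Import GRing.Theory.

(* Build the words letter by letter and remember only the maximum M, the number
   c of letters below M that may still be appended, and whether the last letter
   is M. The effect of appending a letter:
   - a letter m > M turns c into c + (m - M), for both patterns;
   - a letter below M leaves no admissible letter below M for (>,-,>), and
     exactly itself for (>=,<>,>);
   - repeating M keeps c for (>,-,>), and makes it 0 for (>=,<>,>).
   By induction on the number k of letters still to be appended, the weight of
   all extensions of a word ending in its maximum is affine in c, and the two
   patterns have the same affine function g + d c. The induction closes because
   for words ending below M the two weights differ exactly by the slope d. *)

(** * Words read letter by letter and their weights *)

Section Words.

Variable bad : nat -> nat -> nat -> bool.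

(* Prefixes are stored reversed: the head of [s] is the last letter read. *)
Fixpoint ext (s : seq nat) (y : nat) : bool :=
  if s is b :: s' then all (fun a => ~~ bad a b y) s' && ext s' y else true.

Variables (R : comNzRingType) (t : nat -> R).

(** [size s'] is the 0-based position of [b], where the ascent occurs. *)
Definition step_weight (s : seq nat) (y : nat) : R :=
  if s is b :: s' then (if (b < y)%N then t (size s') else 1%R) else 1%R.

Fixpoint word_weight (s w : seq nat) : R :=
  if w is y :: w' then
    if (y <= size s) && ext s y
    then (step_weight s y * word_weight (y :: s) w')%R else 0%R
  else 1%R.

Fixpoint total (k : nat) (s : seq nat) : R :=
  if k is k'.+1 then
    (\sum_(0 <= y < (size s).+1)
      (if ext s y then step_weight s y * total k' (y :: s) else 0))%R
  else 1%R.

Lemma sum_tupleS (T : finType) k (F : seq T -> R) :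
  (\sum_(u : k.+1.-tuple T) F u = \sum_(y : T) \sum_(u : k.-tuple T) F (y :: u))%R.
Proof.
rewrite pair_big /=.
rewrite (reindex (fun p : T * k.-tuple T => [tuple of p.1 :: p.2])) //=.
exists (fun u : k.+1.-tuple T => (thead u, [tuple of behead u])) => [[y u] _|u _] /=.
  by congr pair; apply: val_inj.
by rewrite -tuple_eta.
Qed.

(** The bound on [N] puts every letter allowed in an inversion sequence into ['I_N], so a fixed
    alphabet loses no word. *)
Lemma sum_word_weight N k s : size s + k <= N ->
  (\sum_(u : k.-tuple 'I_N) word_weight s (map val u) = total k s)%R.
Proof.
elim: k s => [|k IHk] s leN.
  rewrite (eq_bigr (fun _ => 1%R)) => [|u _]; last by rewrite tuple0.
  by rewrite sumr_const card_tuple expn0.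
rewrite (sum_tupleS k (fun u => word_weight s (map val u))) /=.
have ltN : size s < N by apply: leq_trans leN; rewrite addnS ltnS leq_addr.
pose G y := (if ext s y then step_weight s y * total k (y :: s) else 0)%R.
rewrite (eq_bigr (fun y : 'I_N => if y < (size s).+1 then G y else 0%R)).
  by rewrite -big_mkcond /= -(big_ord_widen N G ltN) big_mkord.
move=> y _; rewrite ltnS /G.
case: leqP => _ /=; last by rewrite big1.
case: ext; last by rewrite big1.
by rewrite -big_distrr /= IHk //= addSnnS.
Qed.

Fixpoint rev_prefix (f : nat -> nat) (p : nat) : seq nat :=
  if p is p'.+1 then f p' :: rev_prefix f p' else [::].

Lemma size_rev_prefix f p : size (rev_prefix f p) = p.
Proof. by elim: p => //= p ->. Qed.

Lemma all_rev_prefix (P : pred nat) f p :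
  reflect (forall i, i < p -> P (f i)) (all P (rev_prefix f p)).
Proof.
elim: p => [|p IHp] /=; first by apply: ReflectT.
apply: (iffP andP) => [[Pp /IHp Pf] i|Pf].
  by rewrite ltnS leq_eqVlt => /predU1P[->|/Pf].
by split; [exact: Pf | apply/IHp => i ltip; apply/Pf/ltnW].
Qed.

Lemma ext_rev_prefix f p y :
  reflect (forall i j, i < j -> j < p -> ~~ bad (f i) (f j) y)
          (ext (rev_prefix f p) y).
Proof.
elim: p => [|p IHp] /=; first by apply: ReflectT.
apply: (iffP andP) => [[/all_rev_prefix Bp /IHp Bf] i j ltij|Bf].
  rewrite ltnS leq_eqVlt => /predU1P[eqj|]; last exact: Bf.
  by rewrite eqj in ltij *; apply: Bp.
split; first by apply/all_rev_prefix => i ltip; apply: Bf.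
by apply/IHp => i j ltij ltjp; apply: Bf => //; apply: ltnW.
Qed.

Lemma word_weight_rev_prefix f p k :
  word_weight (rev_prefix f p) (map f (iota p k)) =
  (if all (fun i => (f i <= i)%N && ext (rev_prefix f i) (f i)) (iota p k)
   then \prod_(i <- iota p k) step_weight (rev_prefix f i) (f i) else 0)%R.
Proof.
elim: k p => [|k IHk] p /=; first by rewrite big_nil.
rewrite size_rev_prefix big_cons (IHk p.+1).
by case: (_ && _) => //=; case: all => //; rewrite mulr0.
Qed.

End Words.

(** * The recursion on the maximum, common to both patterns *)

Section Recursion.

Variables (R : comNzRingType) (t : nat -> R).
Local Open Scope ring_scope.

(* [table k p M = (g, d, f)]: for a word of length [p] with maximum [M] and [c]
   admissible next letters below [M], the [k]-letter extensions have total
   weight [g + d *+ c] when the last letter is [M]. When it is smaller than [M]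
   they have weight [f] for (>,-,>) and [f + d] for (>=,<>,>). *)
Fixpoint table (k p M : nat) : R * R * R :=
  if k is k'.+1 then
    let g m := (table k' p.+1 m).1.1 in
    let d m := (table k' p.+1 m).1.2 in
    let f m := (table k' p.+1 m).2 in
    let up := \sum_(M.+1 <= m < p.+1) (g m + d m *+ (m - M)) in
    (g M + t p.-1 * up,
     d M + f M + t p.-1 * (\sum_(M.+1 <= m < p.+1) d m),
     t p.-1 * (g M + up))
  else (1, 0, 1).

Variable bad : nat -> nat -> nat -> bool.
(** This and the next property govern letters above the maximum, where both patterns behave
    alike. *)
Hypothesis bad_gt : forall a b y, bad a b y -> (y < a)%N.
Hypothesis bad_ge : forall a b y, bad a b y -> (b <= a)%N.

Definition below (s : seq nat) (M : nat) : nat := count (ext bad s) (iota 0 M).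

Definition is_max (s : seq nat) (M : nat) : bool :=
  all (fun a => (a <= M)%N) s && (M \in s).

(** A forbidden letter is smaller than some earlier one, hence smaller than [M]. *)
Lemma ext_ge_max s M y : all (fun a => (a <= M)%N) s -> (M <= y)%N -> ext bad s y.
Proof.
move=> + leMy; elim: s => //= b s IHs /andP[_ les]; rewrite IHs // andbT.
apply: sub_all les => a leaM; apply: contraTN leaM => /bad_gt lt_ya.
by rewrite -ltnNge (leq_ltn_trans leMy).
Qed.

(** Exceeding all earlier letters, [m] cannot be the middle of an occurrence. *)
Lemma ext_cons_new_max s M m y : all (fun a => (a <= M)%N) s -> (M < m)%N ->
  ext bad (m :: s) y = ext bad s y.
Proof.
move=> les ltMm /=; rewrite (_ : all _ _ = true) //.
apply: sub_all les => a leaM; apply: contraTN leaM => /bad_ge le_ma.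
by rewrite -ltnNge (leq_trans ltMm).
Qed.

(** Letters below [M] keep their status, and those from [M] to [m - 1] are all admissible. *)
Lemma below_cons_new_max s M m : all (fun a => (a <= M)%N) s -> (M < m)%N ->
  below (m :: s) m = (below s M + (m - M))%N.
Proof.
move=> les ltMm.
have iota_m : iota 0 m = iota 0 M ++ iota M (m - M).
  by rewrite -{2}[M]add0n -iotaD subnKC // ltnW.
rewrite /below iota_m count_cat.
rewrite (eq_count (fun y => ext_cons_new_max y les ltMm)); congr addn.
rewrite (eq_count (fun y => ext_cons_new_max y les ltMm)).
rewrite -[RHS](size_iota M); apply/eqP; rewrite -all_count.
by apply/allP => y; rewrite mem_iota => /andP[leMy _]; apply: ext_ge_max les _.
Qed.

Lemma is_max_cons_new s M m : all (fun a => (a <= M)%N) s -> (M < m)%N ->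
  is_max (m :: s) m.
Proof.
move=> les ltMm; rewrite /is_max /= leqnn inE eqxx andbT.
by apply: sub_all les => a /leq_trans; apply; apply: ltnW.
Qed.

Lemma is_max_cons_le s M y : is_max s M -> (y <= M)%N -> is_max (y :: s) M.
Proof. by case/andP=> les Ms leyM; rewrite /is_max /= leyM les inE Ms orbT. Qed.

(** The next letter is below, equal to or above [M]; the last two kinds are always admissible, and
    the last always ascends since [b <= M]. *)
Lemma totalS_max k s b M (p := (size s).+1) :
  is_max (b :: s) M -> (M <= size s)%N ->
  total bad t k.+1 (b :: s) =
    \sum_(0 <= y < M) (if ext bad (b :: s) y then
        (if (b < y)%N then t (size s) else 1) * total bad t k [:: y, b & s] else 0)
    + (if (b < M)%N then t (size s) else 1) * total bad t k [:: M, b & s]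
    + t (size s) * \sum_(M.+1 <= m < p.+1) total bad t k [:: m, b & s].
Proof.
move=> /andP[les _] leMs.
have ltMp : (M < p.+1)%N by rewrite ltnS; apply: leqW.
change (total bad t k.+1 (b :: s)) with (\sum_(0 <= y < p.+1)
  (if ext bad (b :: s) y then step_weight t (b :: s) y *
     total bad t k [:: y, b & s] else 0)).
rewrite (big_cat_nat (n := M)) ?(ltnW ltMp) // -addrA; congr (_ + _).
rewrite big_ltn // (ext_ge_max les (leqnn M)) //; congr (_ + _).
rewrite big_distrr; apply: eq_big_nat => m /andP[ltMm _].
rewrite (ext_ge_max les (ltnW ltMm)) // /step_weight.
by case/andP: (les) => /leq_ltn_trans/(_ ltMm) ->.
Qed.

(** The half of the induction hypothesis that has the same form for both patterns. *)
Definition top_total k := forall s M, is_max (M :: s) M -> (M <= size s)%N ->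
  total bad t k (M :: s) =
    (table k (size s).+1 M).1.1 + (table k (size s).+1 M).1.2 *+ below (M :: s) M.

(** Each [m] is a new maximum with [below s M + (m - M)] admissible letters below it; the two
    summands are separated by linearity. *)
Lemma sum_above_max k s M (p := size s) : top_total k ->
  all (fun a => (a <= M)%N) s ->
  \sum_(M.+1 <= m < p.+1) total bad t k (m :: s) =
    \sum_(M.+1 <= m < p.+1)
        ((table k p.+1 m).1.1 + (table k p.+1 m).1.2 *+ (m - M))
    + (\sum_(M.+1 <= m < p.+1) (table k p.+1 m).1.2) *+ below s M.
Proof.
move=> IHk les; rewrite -sumrMnl -big_split /=.
apply: eq_big_nat => m /andP[ltMm ltmp].
rewrite IHk ?(is_max_cons_new les) // (below_cons_new_max les ltMm) /=.
by rewrite -addrA -mulrnDr addnC.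
Qed.

Lemma sum_below_const s M c (F : nat -> R) :
  (forall y, (y < M)%N -> ext bad s y -> F y = c) ->
  \sum_(0 <= y < M) (if ext bad s y then F y else 0) = c *+ below s M.
Proof.
move=> Fc; rewrite (eq_big_nat _ _ (F2 := fun y => if ext bad s y then c else 0)).
  by rewrite -big_mkcond big_const_seq iter_addr_0 /below /index_iota subn0.
by move=> y /andP[_ ltyM]; case: ifP => // /(Fc y ltyM).
Qed.

End Recursion.

(** * The two patterns follow the same table *)

Section Equidistribution.

Variables (R : comNzRingType) (t : nat -> R).
Local Open Scope ring_scope.

Definition triple (r1 r2 r3 : rel nat) (a b y : nat) : bool :=
  [&& r1 a b, r2 b y & r3 a y].

Let badA := triple geq neqn gtn.
Let badB := triple gtn anyn gtn.

Lemma badA_gt a b y : badA a b y -> (y < a)%N.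
Proof. by case/and3P. Qed.
Lemma badA_ge a b y : badA a b y -> (b <= a)%N.
Proof. by case/and3P. Qed.
Lemma badB_gt a b y : badB a b y -> (y < a)%N.
Proof. by case/and3P. Qed.
Lemma badB_ge a b y : badB a b y -> (b <= a)%N.
Proof. by case/and3P => /ltnW. Qed.

(** A repeated [M] could be a middle letter only after a letter larger than [M]. *)
Lemma extB_cons_max s M : is_max s M -> ext badB (M :: s) =1 ext badB s.
Proof.
case/andP=> les _ y /=; rewrite (_ : all _ _ = true) //.
by apply: sub_all les => a leaM; rewrite /badB /triple /= ltnNge leaM.
Qed.

(** [M], [y], [z] would form an occurrence. *)
Lemma extB_cons_lt s M y z : is_max s M -> (y < M)%N -> (z < M)%N ->
  ext badB (y :: s) z = false.
Proof.
case/andP=> _ Ms ltyM ltzM /=; apply/negP => /andP[/allP/(_ _ Ms)].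
by rewrite /badB /triple /= ltyM ltzM.
Qed.

(** The earlier [M], its repetition and [z] would form an occurrence. *)
Lemma extA_cons_max s M z : is_max s M -> (z < M)%N -> ext badA (M :: s) z = false.
Proof.
case/andP=> _ Ms ltzM /=; apply/negP => /andP[/allP/(_ _ Ms)].
by rewrite /badA /triple /neqn /= leqnn ltzM neq_ltn ltzM orbT.
Qed.

(** If [z] differs from [y], then [M], [y], [z] form an occurrence; a repeated [y] creates none, as
    the last two letters of an occurrence differ. *)
Lemma extA_cons_lt s M y z : is_max s M -> (y < M)%N -> (z < M)%N ->
  ext badA s y -> ext badA (y :: s) z = (z == y).
Proof.
case/andP=> _ Ms ltyM ltzM exty /=; case: (eqVneq z y) => [->|neqzy].
  by rewrite exty andbT; apply/allP => a _; rewrite /badA /triple /neqn /= eqxx andbF.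
apply/negP => /andP[/allP/(_ _ Ms)].
by rewrite /badA /triple /neqn /= (ltnW ltyM) ltzM eq_sym neqzy.
Qed.

(** After a word ending in [M], each of the [c] smaller letters gives [f], and repeating [M] gives
    [g + d c]. *)
Lemma total_B k :
  top_total t badB k /\
  (forall s b M, is_max (b :: s) M -> (b < M)%N -> (M <= size s)%N ->
     (forall z, (z < M)%N -> ext badB (b :: s) z = false) ->
     total badB t k (b :: s) = (table t k (size s).+1 M).2).
Proof.
elim: k => [|k [IHt IHl]]; first by split=> [s M _ _|*]; rewrite /= ?mul0rn ?addr0.
split=> [s M maxM leM|s b M maxM ltbM leM noext].
  rewrite (totalS_max t badB_gt k maxM leM) ltnn mul1r.
  have [les _] := andP maxM.
  rewrite (sum_above_max badB_gt badB_ge IHt les) IHt 1?is_max_cons_le ?(leqW leM) //.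
  rewrite [below badB [:: M, M & s] M](eq_count (extB_cons_max maxM)).
  rewrite (@sum_below_const _ _ _ _ (table t k (size s).+2 M).2); last first.
    move=> y ltyM exty; rewrite ltnNge (ltnW ltyM) /= mul1r.
    rewrite (IHl _ _ M) 1?is_max_cons_le ?(ltnW ltyM) ?(leqW leM) //.
    by move=> z; apply: extB_cons_lt maxM ltyM.
  rewrite -/(below _ _ _); move: (below _ _ _) => c /=; ring.
rewrite (totalS_max t badB_gt k maxM leM) ltbM.
have [les _] := andP maxM.
have below0 : below badB (b :: s) M = 0%N.
  apply/eqP; rewrite -leqn0 leqNgt -has_count; apply/hasPn => z.
  by rewrite mem_iota => /andP[_ /noext ->].
(* Only [M] and larger letters remain, all of them ascents. *)
rewrite big_nat big1 => [|y /andP[_ /noext ->] //]; rewrite add0r.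
rewrite (sum_above_max badB_gt badB_ge IHt les) IHt 1?is_max_cons_le ?(leqW leM) //.
rewrite [below badB [:: M, b & s] M](eq_count (extB_cons_max maxM)).
by rewrite -/(below badB (b :: s) M) below0 !mulr0n !addr0 /= mulrDr.
Qed.

(** Here each of the [c] smaller letters gives [f + d], and repeating [M] gives only [g]: the term
    [d c] has moved, but the sum is that of [total_B]. *)
Lemma total_A k :
  top_total t badA k /\
  (forall s b M, is_max (b :: s) M -> (b < M)%N -> (M <= size s)%N ->
     (forall z, (z < M)%N -> ext badA (b :: s) z = (z == b)) ->
     total badA t k (b :: s) =
       (table t k (size s).+1 M).2 + (table t k (size s).+1 M).1.2).
Proof.
elim: k => [|k [IHt IHl]]; first by split=> [s M _ _|*]; rewrite /= ?mul0rn ?addr0.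
have below_rep s M : is_max s M -> below badA (M :: s) M = 0%N.
  move=> maxM; apply/eqP; rewrite -leqn0 leqNgt -has_count; apply/hasPn => z.
  by rewrite mem_iota => /andP[_ ltzM]; rewrite extA_cons_max.
split=> [s M maxM leM|s b M maxM ltbM leM extb].
  rewrite (totalS_max t badA_gt k maxM leM) ltnn mul1r.
  have [les _] := andP maxM.
  rewrite (sum_above_max badA_gt badA_ge IHt les) IHt 1?is_max_cons_le ?(leqW leM) //.
  rewrite below_rep // mulr0n addr0.
  rewrite (@sum_below_const _ _ _ _
    ((table t k (size s).+2 M).2 + (table t k (size s).+2 M).1.2)); last first.
    move=> y ltyM exty; rewrite ltnNge (ltnW ltyM) /= mul1r.
    rewrite (IHl _ _ M) 1?is_max_cons_le ?(ltnW ltyM) ?(leqW leM) //.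
    by move=> z ltzM; apply: extA_cons_lt maxM ltyM ltzM exty.
  move: (below _ _ _) => c /=; ring.
rewrite (totalS_max t badA_gt k maxM leM) ltbM.
have [les _] := andP maxM.
(* Repeating [b] gives [f + d] without an ascent, and [c = 1] adds one sum of slopes above [M]:
   together they are the new [d]. *)
have extbb : ext badA (b :: s) b by rewrite extb.
have below1 : below badA (b :: s) M = 1%N.
  rewrite /below (eq_in_count (a2 := pred1 b)).
    by rewrite count_uniq_mem ?iota_uniq // mem_iota add0n ltbM.
  by move=> z; rewrite mem_iota => /andP[_ /extb].
rewrite (@sum_below_const _ _ _ _
    ((table t k (size s).+2 M).2 + (table t k (size s).+2 M).1.2)); last first.
  move=> y ltyM; rewrite extb // => /eqP->; rewrite ltnn mul1r.
  rewrite (IHl _ _ M) 1?is_max_cons_le ?(ltnW ltbM) ?(leqW leM) //.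
  by move=> z ltzM; apply: extA_cons_lt maxM ltbM ltzM extbb.
rewrite (sum_above_max badA_gt badA_ge IHt les) IHt 1?is_max_cons_le ?(leqW leM) //.
rewrite below_rep // below1 mulr0n addr0 !mulr1n /=.
ring.
Qed.

(** The first letter is 0, a maximum with nothing below it, so both totals are the same entry of
    [table]. *)
Lemma total_avoid_eq k : total badA t k [::] = total badB t k [::].
Proof.
case: k => // k /=; rewrite !big_nat1 /= !mul1r.
rewrite (total_A k).1 // (total_B k).1 //.
Qed.

End Equidistribution.

(** * Back to inversion sequences *)

Section Linking.

Local Open Scope ring_scope.

Variables (m : nat) (r1 r2 r3 : rel nat).
Local Notation n := m.+1.

Lemma invseq_weight (e : {ffun 'I_n -> 'I_n}) :
  (if e \in invseq_avoid n r1 r2 r3 then tmon (Asc e) else 0) =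
  word_weight (triple r1 r2 r3) (fun i => 'X_(inord i) : {mpoly int[n]}) [::]
    (map val (codom e)).
Proof.
pose f (i : nat) : nat := e (inord i).
have fE (i : 'I_n) : f i = e i by rewrite /f inord_val.
have -> : map val (codom e) = map f (iota 0 n).
  rewrite -val_enum_ord /codom /image_mem -!map_comp.
  by apply: eq_map => i /=; rewrite fE.
rewrite (word_weight_rev_prefix (triple r1 r2 r3) _ f 0 n).
congr (if _ then _ else _).
  rewrite !inE; apply/andP/allP => [[/forallP lee avoid] i|good].
    rewrite mem_iota => /andP[_ ltin].
    rewrite -[i]/(val (Ordinal ltin)) fE lee /=.
    apply/ext_rev_prefix => a b ltab ltbi; apply: contra avoid => bad_abi.
    have ltbn := ltn_trans ltbi ltin.
    apply/existsP; exists (Ordinal (ltn_trans ltab ltbn)).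
    apply/existsP; exists (Ordinal ltbn).
    apply/existsP; exists (Ordinal ltin).
    by move: bad_abi; rewrite /= ltab ltbi -!fE.
  have {}good (i : 'I_n) :
      (f i <= i)%N && ext (triple r1 r2 r3) (rev_prefix f i) (f i).
    by apply: good; rewrite mem_iota ltn_ord.
  split.
    apply/forallP => i; rewrite -fE.
    by have /andP[] := good i.
  apply/negP => /existsP[i /existsP[j /existsP[k /and3P[ltij ltjk bad_ijk]]]].
  have /andP[_] := good k.
  by move/ext_rev_prefix/(_ _ _ ltij ltjk); rewrite /triple !fE bad_ijk.
(* The first letter has weight 1 and the last position has no ascent; dropping both matches letter
   [i.+1] with the ascent at [i]. *)
rewrite /tmon -[iota 0 n]/(index_iota 0 n) big_mkord big_ord_recl mul1r.
rewrite big_mkcond big_ord_recr /=.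
have -> : (ord_max \in Asc e) = false.
  apply/negP; rewrite inE => /existsP[j /andP[/eqP eqj _]].
  by have := ltn_ord j; rewrite eqj ltnn.
rewrite mulr1; apply: eq_bigr => i _.
rewrite -[RHS]/(if (f i < f i.+1)%N then 'X_(inord (size (rev_prefix f i))) else 1).
rewrite size_rev_prefix.
have ei : widen_ord (leqnSn m) i = inord i.
  by apply: val_inj; rewrite /= inordK // ltnS ltnW.
rewrite ei; congr (if _ then _ else _); rewrite inE.
apply/existsP/idP => [[j /andP[/eqP]]|lt_f].
  by rewrite -ei /= => eqj; rewrite ei /f -eqj inord_val.
by exists (inord i.+1); rewrite -{1}ei /= inordK ?ltnS ?eqxx.
Qed.

Lemma sum_invseq_avoid :
  \sum_(e in invseq_avoid n r1 r2 r3) tmon (Asc e) =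
  total (triple r1 r2 r3) (fun i => 'X_(inord i) : {mpoly int[n]}) n [::].
Proof.
rewrite -(sum_word_weight _ _ (N := n)) // big_mkcond /=.
rewrite (reindex (fun e : {ffun 'I_n -> 'I_n} => mktuple e)) /=.
  by apply: eq_bigr => e _; rewrite invseq_weight.
exists (fun u : n.-tuple 'I_n => [ffun i => tnth u i]) => [e _|u _].
  by apply/ffunP => i; rewrite ffunE tnth_mktuple.
by apply: eq_from_tnth => i; rewrite tnth_mktuple ffunE.
Qed.

End Linking.

Theorem theorem1p2 (n : nat) (hn : 1 <= n) :
  (\sum_(e in invseq_avoid n geq neqn gtn) tmon (Asc e) =
   \sum_(e in invseq_avoid n gtn anyn gtn) tmon (Asc e))%R.
Proof.
by case: n hn => // m _; rewrite !sum_invseq_avoid total_avoid_eq.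
Qed.
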